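(* Let $E=(B,X,A,\alpha,\beta,\kappa,\lambda)$ and $F=(D,Y,B,\gamma,\delta,\mu,\nu)$ be split extensions of magmas. If $E$ and $F$ are firm, then so is their composite $FE=(D,Z,A,\gamma\alpha,\beta\delta,\mu',\nu')$.
   Context: A (unitary) magma is a set $M$ with an element $0$ and a binary operation $+$ satisfying $0+x=x=x+0$ for all $x\in M$ (no other axiom). A magma homomorphism is a map preserving $0$ and $+$. Sums of maps are taken pointwise; $1$ denotes identity maps and $0$ also denotes constant zero maps. Split extension of magmas: a seven-tuple $E=(B,X,A,\alpha,\beta,\kappa,\lambda)$ where $B,X,A$ are magmas, $\alpha:A\to B$, $\beta:B\to A$, $\kappa:X\to A$ are magma homomorphisms, $\lambda:A\to X$ is a map with $\lambda(0)=0$ (not necessarily preserving addition), and, for all $x\in X$, $a\in A$, $b\in B$: $\lambda\kappa=1$, $\alpha\beta=1$; $\lambda\beta=0$, $\alpha\kappa=0$; $\kappa\lambda+\beta\alpha=1$; $\lambda(\kappa(x)+\beta(b))=x$; $\kappa(x)+(\beta(b)+a)=(\kappa(x)+\beta(b))+a$; $\kappa(x)+(a+\beta(b))=(\kappa(x)+a)+\beta(b)$; $a+(\kappa(x)+\beta(b))=(a+\kappa(x))+\beta(b)$. The associated action of $B$ on $X$ is $bx=\lambda(\beta(b)+\kappa(x))$. The split extension $E$ is called firm if $b'(bx)=(b'+b)x$ for all $b,b'\in B$, $x\in X$, for this associated action. For split extensions $E=(B,X,A,\alpha,\beta,\kappa,\lambda)$ and $F=(D,Y,B,\gamma,\delta,\mu,\nu)$,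 put $Z=\alpha^{-1}(\mu(Y))$, a submagma of $A$, let $\mu':Z\to A$ be the inclusion, and let $\nu':A\to Z$ be defined by $\nu'(a)=\kappa\lambda(a)+\beta\mu\nu\alpha(a)$. The pair $(F,E)$ is called composable if the seven-tuple $(D,Z,A,\gamma\alpha,\beta\delta,\mu',\nu')$ is a split extension of magmas; this seven-tuple is then called the composite of $F$ and $E$ and denoted $FE$. Whenever $E$ is firm, $(F,E)$ is composable, so the composite $FE$ exists. *)

(* Defs.v *)
From HB Require Import structures.
From mathcomp Require Import all_boot ssralg.
From mathcomp Require Import boolp classical_sets.

Set Implicit Arguments.
Unset Strict Implicit.
Unset Printing Implicit Defensive.

Import GRing.Theory.
Local Open Scope classical_set_scope.
Local Open Scope ring_scope.

(* Unitary magmas in additive notation, with no further axiom: MathComp's      *)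
(* addUMagmaType would add commutativity and umagmaType is multiplicative.     *)
(* Homomorphisms are MathComp's {additive M -> N}, which at this level of the  *)
(* hierarchy means preservation of 0 and + only.                               *)
HB.mixin Record BaseAddUMagma_isUnital M of Algebra.BaseAddUMagma M := {
  unital_add0r : left_id 0 (@Algebra.add M);
  unital_addr0 : right_id 0 (@Algebra.add M)
}.

#[short(type="unitalMagmaType")]
HB.structure Definition UnitalMagma :=
  {M of BaseAddUMagma_isUnital M & Algebra.BaseAddUMagma M}.

Record splitTuple (B X A : unitalMagmaType) := SplitTuple {
  alpha : {additive A -> B};
  beta : {additive B -> A};
  kappa : {additive X -> A};
  lambda : A -> X
}.

(* lambda is only required to preserve 0, not addition. *)
Record isSplitExtension (B X A : unitalMagmaType) (E : splitTuple B X A) :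
    Prop := IsSplitExtension {
  lambda0 : lambda E 0 = 0;
  lambda_kappa : forall x, lambda E (kappa E x) = x;
  alpha_beta : forall b, alpha E (beta E b) = b;
  lambda_beta : forall b, lambda E (beta E b) = 0;
  alpha_kappa : forall x, alpha E (kappa E x) = 0;
  kappa_lambdaD : forall a, kappa E (lambda E a) + beta E (alpha E a) = a;
  lambda_kappaD : forall x b, lambda E (kappa E x + beta E b) = x;
  kappa_betaA : forall x b a,
    kappa E x + (beta E b + a) = (kappa E x + beta E b) + a;
  kappaA_beta : forall x a b,
    kappa E x + (a + beta E b) = (kappa E x + a) + beta E b;
  A_kappa_beta : forall a x b,
    a + (kappa E x + beta E b) = (a + kappa E x) + beta E b
}.

Record splitExtension (B X A : unitalMagmaType) := SplitExtension {
  tuple_of :> splitTuple B X A;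
  tuple_ofP : isSplitExtension tuple_of
}.

Definition act (B X A : unitalMagmaType) (E : splitExtension B X A)
  (b : B) (x : X) : X := lambda E (beta E b + kappa E x).

Definition firm (B X A : unitalMagmaType) (E : splitExtension B X A) : Prop :=
  forall (b b' : B) (x : X), act E b' (act E b x) = act E (b' + b) x.

Section ActionTheory.
Variables (B X A : unitalMagmaType) (E : splitExtension B X A).
Let EP := tuple_ofP E.

Lemma act0 b : act E b 0 = 0.
Proof. by rewrite /act raddf0 unital_addr0 (lambda_beta EP). Qed.

Lemma beta_kappaE b x :
  beta E b + kappa E x = kappa E (act E b x) + beta E b.
Proof.
rewrite -[LHS](kappa_lambdaD EP) /act raddfD (alpha_beta EP) (alpha_kappa EP).
by rewrite unital_addr0.
Qed.

Lemma kappa_beta_addE x b x' b' :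
  (kappa E x + beta E b) + (kappa E x' + beta E b') =
  kappa E (x + act E b x') + beta E (b + b').
Proof.
rewrite (A_kappa_beta EP) -(kappa_betaA EP) beta_kappaE (kappaA_beta EP).
by rewrite -raddfD -(kappa_betaA EP) -raddfD.
Qed.

Lemma kappa_beta_ex a : exists x b, a = kappa E x + beta E b.
Proof. by exists (lambda E a), (alpha E a); rewrite (kappa_lambdaD EP). Qed.

Lemma alpha_kappa_beta x b : alpha E (kappa E x + beta E b) = b.
Proof. by rewrite raddfD (alpha_kappa EP) (alpha_beta EP) unital_add0r. Qed.

Lemma beta_kappa_betaE b : beta E b = kappa E 0 + beta E b.
Proof. by rewrite raddf0 unital_add0r. Qed.

End ActionTheory.

Section Composite.
Variables (B X A D Y : unitalMagmaType).
Variables (F : splitExtension D Y B) (E : splitExtension B X A).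

(* The submagma Z = alpha^-1(mu(Y)) of A, as a type. For F, the maps usually    *)
(* written gamma, delta, mu, nu are alpha F, beta F, kappa F, lambda F.        *)
Definition compKer : Type := alpha E @^-1` range (kappa F).

Let compKer_val (z : compKer) : A := \val z.

Fact compKer0_subproof : (0 : A) \in alpha E @^-1` range (kappa F).
Proof. by rewrite inE /=; exists 0 => //; rewrite !raddf0. Qed.

Fact compKerD_subproof (z t : compKer) :
  compKer_val z + compKer_val t \in alpha E @^-1` range (kappa F).
Proof.
case: z t => [a az] [b bz]; rewrite /compKer_val /= inE /=.
move: az bz; rewrite !inE => -[y _ ay] [y' _ by'].
by exists (y + y') => //; rewrite !raddfD ay by'.
Qed.

Definition compKer_zero : compKer := exist _ 0 compKer0_subproof.
Definition compKer_add (z t : compKer) : compKer :=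
  exist _ (compKer_val z + compKer_val t) (compKerD_subproof z t).

HB.instance Definition _ := Algebra.hasAdd.Build compKer compKer_add.
HB.instance Definition _ := Algebra.hasZero.Build compKer compKer_zero.

Fact compKer_add0r : left_id 0 (@Algebra.add compKer).
Proof. by move=> z; apply: val_inj; apply: unital_add0r. Qed.

Fact compKer_addr0 : right_id 0 (@Algebra.add compKer).
Proof. by move=> z; apply: val_inj; apply: unital_addr0. Qed.

HB.instance Definition _ :=
  BaseAddUMagma_isUnital.Build compKer compKer_add0r compKer_addr0.

Definition comp_kappa (z : compKer) : A := \val z.

Fact comp_kappa_nmod_morphism : nmod_morphism comp_kappa.
Proof. by []. Qed.

HB.instance Definition _ :=
  Algebra.isNmodMorphism.Build compKer A comp_kappa comp_kappa_nmod_morphism.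

Definition comp_lambda_val (a : A) : A :=
  kappa E (lambda E a) + beta E (kappa F (lambda F (alpha E a))).

Fact comp_lambda_subproof (a : A) :
  comp_lambda_val a \in alpha E @^-1` range (kappa F).
Proof.
rewrite inE /comp_lambda_val /=; exists (lambda F (alpha E a)) => //.
have EP := tuple_ofP E.
by rewrite raddfD (alpha_kappa EP) (alpha_beta EP) unital_add0r.
Qed.

Definition comp_lambda (a : A) : compKer := exist _ (comp_lambda_val a) (comp_lambda_subproof a).

Definition compTuple : splitTuple D compKer A :=
  @SplitTuple D compKer A (alpha F \o alpha E) (beta E \o beta F)
    comp_kappa comp_lambda.

Definition composable : Prop := isSplitExtension compTuple.

Definition composite (FE : composable) : splitExtension D compKer A :=
  SplitExtension FE.

Lemma compKerE (z : compKer) :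
  exists x y, \val z = kappa E x + beta E (kappa F y).
Proof.
have := valP z; rewrite inE => -[y _ ay].
by exists (lambda E (\val z)), y; rewrite ay (kappa_lambdaD (tuple_ofP E)).
Qed.

Lemma firm_composable : firm E -> composable.
Proof.
move=> firmE; have EP := tuple_ofP E; have FP := tuple_ofP F.
have lamE a : \val (comp_lambda a) = comp_lambda_val a by [].
split=> /=.
- apply: val_inj; rewrite lamE /comp_lambda_val (lambda0 EP) !raddf0.
  by rewrite (lambda0 FP) !raddf0 unital_add0r.
- move=> z; apply: val_inj; rewrite lamE /comp_lambda_val /comp_kappa.
  have [x [y ->]] := compKerE z.
  by rewrite alpha_kappa_beta (lambda_kappaD EP) (lambda_kappa FP).
- by move=> d; rewrite (alpha_beta EP) (alpha_beta FP).
- move=> d; apply: val_inj; rewrite lamE /comp_lambda_val.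
  by rewrite (lambda_beta EP) (alpha_beta EP) (lambda_beta FP) !raddf0
    unital_add0r.
- move=> z; rewrite /comp_kappa; have [x [y ->]] := compKerE z.
  by rewrite alpha_kappa_beta (alpha_kappa FP).
- move=> a; rewrite /comp_kappa lamE /comp_lambda_val -(kappa_betaA EP).
  by rewrite -raddfD (kappa_lambdaD FP) (kappa_lambdaD EP).
- move=> z d; apply: val_inj; rewrite lamE /comp_lambda_val /comp_kappa.
  have [x [y ->]] := compKerE z.
  rewrite -(kappa_betaA EP) -raddfD (lambda_kappaD EP) alpha_kappa_beta.
  by rewrite (lambda_kappaD FP).
- move=> z d a; rewrite /comp_kappa; have [x [y ->]] := compKerE z.
  have [x' [b' ->]] := kappa_beta_ex E a.
  rewrite (beta_kappa_betaE E (beta F d)) !kappa_beta_addE unital_add0r act0.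
  by rewrite unital_addr0 firmE (kappa_betaA FP).
- move=> z a d; rewrite /comp_kappa; have [x [y ->]] := compKerE z.
  have [x' [b' ->]] := kappa_beta_ex E a.
  rewrite (beta_kappa_betaE E (beta F d)) !kappa_beta_addE !act0 !unital_addr0.
  by rewrite (kappaA_beta FP).
- move=> a z d; rewrite /comp_kappa; have [x [y ->]] := compKerE z.
  have [x' [b' ->]] := kappa_beta_ex E a.
  rewrite (beta_kappa_betaE E (beta F d)) !kappa_beta_addE !act0 !unital_addr0.
  by rewrite (A_kappa_beta FP).
Qed.

End Composite.

(* Main.v *)
Require Import Defs.
From mathcomp Require Import all_boot ssralg.

(** Every element of Z can be written as kappa x + beta (mu y).  In these
    coordinates the action of D on Z is componentwise: d acts on y by the action
    of F, and on x by the action of E restricted along delta.  Since delta is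
    additive, the law d'(dz) = (d' + d)z then splits into the same law for F on
    y and for E on x. *)

Set Implicit Arguments.
Unset Strict Implicit.

Import GRing.Theory.
Local Open Scope ring_scope.

(** Moving beta (delta d) past kappa x gives delta d acting on x, and leaves
    beta (delta d + mu y), whose nu-component is d acting on y. *)
Lemma act_composite (B X A D Y : unitalMagmaType)
    (E : splitExtension B X A) (F : splitExtension D Y B)
    (FE : composable F E) (d : D) (z : compKer F E) (x : X) (y : Y) :
  \val z = kappa E x + beta E (kappa F y) ->
  \val (act (composite FE) d z) =
    kappa E (act E (beta F d) x) + beta E (kappa F (act F d y)).
Proof.
move=> zE; rewrite [LHS]/= /comp_lambda_val /= /comp_kappa zE.
rewrite (beta_kappa_betaE E (beta F d)) kappa_beta_addE unital_add0r.
by rewrite (lambda_kappaD (tuple_ofP E)) alpha_kappa_beta.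
Qed.

Theorem theorem3p7 (B X A D Y : unitalMagmaType)
    (E : splitExtension B X A) (F : splitExtension D Y B)
    (firmE : firm E) (firmF : firm F) :
  firm (composite (firm_composable F firmE)).
Proof.
move=> d d' z; apply: val_inj; have [x [y zE]] := compKerE z.
rewrite (act_composite _ _ (act_composite (firm_composable F firmE) d zE)).
by rewrite (act_composite _ _ zE) firmE firmF raddfD.
Qed.
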